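(* Let $T$ be a dataset with sensitive attributes $\mathbf{S}$ and label $Y$ with values $y\in\{y_1,\dots,y_k\}$, and for a group $\mathbf{s}$ let $i=\arg\max_j\frac{\mathbf{s}y_j}{y_j}$. Consider the system of equations $$\frac{\mathbf{s}y+\Delta\mathbf{s}y}{f_y}=\frac{\mathbf{s}y_i+\Delta\mathbf{s}y_i}{f_{y_i}}\qquad\text{for every } y\in\{y_1,\dots,y_k\},$$ whose unknowns are the numbers $\Delta\mathbf{s}y$ of tuples to be added. The general solution of this system is $$\Delta\mathbf{s}y=-\mathbf{s}y+\left\lfloor\frac{f_y}{f_{y_i}}\left(\mathbf{s}y_i+\Delta\mathbf{s}y_i\right)\right\rfloor$$ for every group $\mathbf{s}$ and label value $y$, for $\Delta\mathbf{s}y_i\ge 0$. For a given value of $\Delta\mathbf{s}y_i$ (the free variable), this solution determines the number of tuples that need to be added to each sensitive group to produce a mitigated dataset $T_m$ that is unbiased. Specifically, $T_m$ contains $\Delta\mathbf{s}y$ new tuples from group $\mathbf{s}$ with label $y$. Tuples with missing values are not considered, i.e. all the added tuples need to have a value for each sensitive attribute.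
   Context: A dataset $T$ is a finite table whose tuples each have a value $\mathbf{s}\in Dom(\mathbf{S})=\prod_{S\in\mathbf{S}}Dom(S)$ of the sensitive attributes (the tuples with value $\mathbf{s}$ form the group $\mathbf{s}$) and a label value in $\{y_1,\dots,y_k\}$. In formulas a value stands for the number of tuples of $T$ having it: $\mathbf{s}y$ is the number of tuples in group $\mathbf{s}$ with label $y$, $\mathbf{s}$ the number of tuples in group $\mathbf{s}$, $y$ the number of tuples with label $y$, and $n$ the total number of tuples. Put $f_y=y/n$ and $f_{\mathbf{s},y}=\mathbf{s}y/\mathbf{s}$; the quantities in the system and in the solution are computed in the original dataset $T$. $\Delta\mathbf{s}y$ is the number of tuples of group $\mathbf{s}$ with label $y$ added to $T$ (only additions, no deletions, are considered), so it is a non-negative integer. A dataset is unbiased if, with the frequencies of that dataset, $f_{\mathbf{s},y}=f_y$ for every $\mathbf{s}\in Dom(\mathbf{S})$ and every label value $y$.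
   Formalization: Because of the floor, the formula solves the system only if the rounded quantities are integers; unbiasedness of T_m is claimed only when the formula solves the system (otherwise a bias bound), every label occurring in T and every group non-empty in T_m. *)

(* Defs.v *)
From HB Require Import structures.
From mathcomp Require Import all_boot all_order all_algebra.

Set Implicit Arguments.
Unset Strict Implicit.
Unset Printing Implicit Defensive.

Import Order.TTheory GRing.Theory Num.Theory.
Local Open Scope ring_scope.

(* Dom(S), the product of the domains of the sensitive attributes. *)
Definition group (A : finType) (Dom : A -> finType) : finType :=
  {dffun forall a : A, Dom a}.

(* [sens] is a total assignment of the sensitive attributes, so a row never has
   a missing sensitive value; [other] holds the remaining attributes. *)
Record row (A : finType) (Dom : A -> finType) (Y : finType) (X : Type) := Row {
  sens : group Dom;
  label : Y;
  other : X
}.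

(* A table may contain the same row several times. *)
Definition dataset (A : finType) (Dom : A -> finType) (Y : finType) (X : Type) :=
  seq (row Dom Y X).

Section Counts.
Variables (A : finType) (Dom : A -> finType) (Y : finType) (X : Type).
Implicit Types (T N : dataset Dom Y X) (s : group Dom) (y i : Y).

Definition num_sy T s y : nat :=
  count (fun t => (sens t == s) && (label t == y)) T.

Definition num_s T s : nat := count (fun t => sens t == s) T.

Definition num_y T y : nat := count (fun t => label t == y) T.

Definition freq_y T y : rat := (num_y T y)%:R / (size T)%:R.

Definition freq_sy T s y : rat := (num_sy T s y)%:R / (num_s T s)%:R.

Definition unbiased T : Prop := forall s y, freq_sy T s y = freq_y T y.

(* The argmax need not be unique: any maximiser is accepted. *)
Definition is_argmax T s i : Prop :=
  forall j, (num_sy T s j)%:R / (num_y T j)%:R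
            <= (num_sy T s i)%:R / (num_y T i)%:R :> rat.

Definition solves_system T s i (d : Y -> int) : Prop :=
  forall y, ((num_sy T s y)%:Z + d y)%:~R / freq_y T y
            = ((num_sy T s i)%:Z + d i)%:~R / freq_y T i.

(* f_y / f_{y_i} * (s y_i + c), before rounding, where c is the value given to
   the free variable. *)
Definition target T s i (c : int) y : rat :=
  freq_y T y / freq_y T i * ((num_sy T s i)%:Z + c)%:~R.

Definition general_solution T s i (c : int) y : int :=
  - (num_sy T s y)%:Z + Num.floor (target T s i c y).

Definition contains_exactly N (d : group Dom -> Y -> int) : Prop :=
  forall s y, (num_sy N s y)%:Z = d s y.

End Counts.

(* Main.v *)
(* Every solution of the system makes group s proportional to (f_y)_y, with
   factor K s = (s y_i + c) / f_(y_i), so a dataset obtained from an exact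
   solution is unbiased. Rounding down moves each count by less than one tuple
   and the size of each group by less than k; hence in a rounded dataset
   |s y - f_y s| < k for every group, and summing over the groups bounds
   |y - f_y n|. *)

Require Import Defs.
From HB Require Import structures.
From mathcomp Require Import all_boot all_order all_algebra.
From mathcomp Require Import ring lra zify.

Set Implicit Arguments.
Unset Strict Implicit.
Unset Printing Implicit Defensive.

Import Order.TTheory GRing.Theory Num.Theory.
Local Open Scope ring_scope.

(** * Fibrewise counting and rounding errors *)

Lemma sum_count_eq (U : Type) (I : finType) (f : U -> I) (P : pred U)
    (r : seq U) :
  \sum_j count (fun t => P t && (f t == j)) r = count P r.
Proof.
elim: r => [|t r IHr] /=; first by rewrite big1.
rewrite big_split /= IHr; congr addn; case: (P t) => /=; last by rewrite big1.
rewrite (bigD1 (f t)) //= eqxx big1 // => j /negPf nj.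
by rewrite eq_sym nj.
Qed.

(* With errors [e = f K - a] in [0, 1), the quantity bounded is
   [- e y + f y * \sum_z e z]. *)
Lemma rounded_share_error (R : realFieldType) (I : finType) (f a : I -> R)
    (K : R) (y : I) :
  (forall z, 0 <= f z) -> \sum_z f z = 1 ->
  (forall z, a z <= f z * K < a z + 1) ->
  `|a y - f y * \sum_z a z| < #|I|%:R.
Proof.
move=> f0 f1 aK.
have card0 : (0 < #|I|)%N by apply/card_gt0P; exists y.
have card1 : 1 <= #|I|%:R :> R by rewrite ler1n.
have suma : \sum_z a z = K - \sum_z (f z * K - a z).
  by rewrite sumrB -mulr_suml f1 mul1r subKr.
have e0 : 0 <= \sum_z (f z * K - a z).
  by apply: sumr_ge0 => z _; rewrite subr_ge0; case/andP: (aK z).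
have ek : \sum_z (f z * K - a z) < #|I|%:R.
  have -> : #|I|%:R = \sum_(z : I) (1 : R) by rewrite sumr_const.
  apply: ltr_sum; first by apply/hasP; exists y => //; rewrite mem_index_enum.
  by move=> z _; rewrite ltrBlDl; case/andP: (aK z).
have fy1 : f y <= 1.
  by rewrite -f1 (bigD1 y) //= lerDl sumr_ge0.
have /andP[ay1 ay2] := aK y; have fy0 := f0 y.
rewrite suma; move: e0 ek; set E := \sum_z _ => e0 ek.
have fE0 : 0 <= f y * E by rewrite mulr_ge0.
have fE1 : f y * E <= E by rewrite ler_piMl.
(* Here [-1 < a y - f y * K <= 0] and [0 <= f y * E <= E < #|I|]; the lower bound needs
   [1 <= #|I|]. *)
rewrite ltr_norml mulrBr; apply/andP; split; lra.
Qed.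

(** * Counts, frequencies and bias of a dataset *)

Section Counting.
Variables (A : finType) (Dom : A -> finType) (Y : finType) (X : Type).
Implicit Types (T N : dataset Dom Y X) (s : group Dom) (y i : Y).

Lemma num_syD T N s y : num_sy (T ++ N) s y = (num_sy T s y + num_sy N s y)%N.
Proof. exact: count_cat. Qed.

Lemma sum_num_sy_label T s : \sum_y num_sy T s y = num_s T s.
Proof. exact: sum_count_eq. Qed.

Lemma sum_num_sy_group T y : \sum_s num_sy T s y = num_y T y.
Proof.
rewrite /num_y -(sum_count_eq (fun t => sens t)).
by apply: eq_bigr => s _; apply: eq_count => t; rewrite andbC.
Qed.

Lemma sum_num_y T : \sum_y num_y T y = size T.
Proof. by rewrite -count_predT -(sum_count_eq (fun t => label t)). Qed.

Lemma sum_num_s T : \sum_s num_s T s = size T.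
Proof. by rewrite -count_predT -(sum_count_eq (fun t => sens t)). Qed.

Lemma freq_y_gt0 T y : (0 < num_y T y)%N -> 0 < freq_y T y.
Proof.
move=> y0; rewrite divr_gt0 // ltr0n //.
exact: leq_trans y0 (count_size _ _).
Qed.

Lemma sum_freq_y T : (0 < size T)%N -> \sum_y freq_y T y = 1.
Proof.
move=> T0; rewrite -mulr_suml -natr_sum sum_num_y divff //.
by rewrite pnatr_eq0 -lt0n.
Qed.

(** Concatenate one constant block of rows per pair of group and label; [x] fills the remaining
    attributes. *)
Lemma exists_dataset (x : X) (d : group Dom -> Y -> int) :
  (forall s y, 0 <= d s y) -> exists N, contains_exactly N d.
Proof.
move=> d0; pose rows (p : group Dom * Y) := nseq `|d p.1 p.2|%N (Row p.1 p.2 x).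
exists (flatten [seq rows p | p <- enum {: group Dom * Y}]) => s y.
rewrite /num_sy count_flatten -map_comp sumnE big_map big_enum /=.
rewrite (bigD1 (s, y)) //= big1 => [|[s' y'] ne].
  by rewrite count_nseq /= !eqxx mul1n addn0 gez0_abs.
rewrite count_nseq /=; case: andP => // -[/eqP es /eqP ey].
by rewrite es ey eqxx in ne.
Qed.

(** Summing over labels identifies [K s] with the size of group [s]; summing over groups then makes
    both frequencies equal to [f y]. *)
Lemma unbiased_of_proportional T (f : Y -> rat) (K : group Dom -> rat) :
  \sum_y f y = 1 -> (forall s, (0 < num_s T s)%N) ->
  (forall s y, (num_sy T s y)%:R = f y * K s) -> unbiased T.
Proof.
move=> f1 s0 TK s y.
have sK s' : (num_s T s')%:R = K s'.
  rewrite -sum_num_sy_label natr_sum (eq_bigr _ (fun y _ => TK s' y)).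
  by rewrite -mulr_suml f1 mul1r.
have Ks : K s != 0 by rewrite -sK pnatr_eq0 -lt0n.
have T0 : (size T)%:R != 0 :> rat.
  by rewrite pnatr_eq0 -lt0n (leq_trans (s0 s)) ?count_size.
have sizeK : (size T)%:R = \sum_s' K s'.
  by rewrite -sum_num_s natr_sum; apply: eq_bigr.
rewrite /freq_sy /freq_y TK sK mulfK // -sum_num_sy_group natr_sum.
rewrite (eq_bigr _ (fun s' _ => TK s' y)) -mulr_sumr -sizeK mulfK //.
Qed.

Lemma bias_of_nearly_proportional T (f : Y -> rat) (K : group Dom -> rat) s y :
  (forall z, 0 <= f z) -> \sum_z f z = 1 -> (0 < num_s T s)%N ->
  (forall s' z, (num_sy T s' z)%:R <= f z * K s' < (num_sy T s' z)%:R + 1) ->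
  `|freq_sy T s y - freq_y T y|
    < #|Y|%:R * ((num_s T s)%:R^-1 + #|group Dom|%:R / (size T)%:R).
Proof.
move=> f0 f1 s0 TK.
have err s' : `|(num_sy T s' y)%:R - f y * (num_s T s')%:R| < #|Y|%:R :> rat.
  rewrite -sum_num_sy_label natr_sum.
  exact: rounded_share_error f0 f1 (TK s').
have errT : `|(num_y T y)%:R - f y * (size T)%:R|
    <= #|Y|%:R * #|group Dom|%:R :> rat.
  rewrite -sum_num_sy_group -sum_num_s !natr_sum mulr_sumr -sumrB.
  apply: le_trans (ler_norm_sum _ _ _) _.
  rewrite mulr_natr -sumr_const; apply: ler_sum => s' _; exact: ltW.
have ns0 : 0 < (num_s T s)%:R :> rat by rewrite ltr0n.
have nT0 : 0 < (size T)%:R :> rat.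
  by rewrite ltr0n (leq_trans s0) ?count_size.
(* Both frequencies are compared with [f y]: [err] divided by the group size, [errT] by the table
   size. *)
apply: le_lt_trans (ler_distD (f y) _ _) _.
rewrite mulrDr mulrA; apply: ltr_leD.
  have -> : freq_sy T s y - f y
      = ((num_sy T s y)%:R - f y * (num_s T s)%:R) / (num_s T s)%:R.
    by rewrite /freq_sy; field; rewrite gt_eqF.
  by rewrite normrM normfV (gtr0_norm ns0) ltr_pM2r ?invr_gt0.
rewrite distrC.
have -> : freq_y T y - f y
    = ((num_y T y)%:R - f y * (size T)%:R) / (size T)%:R.
  by rewrite /freq_y; field; rewrite gt_eqF.
by rewrite normrM normfV (gtr0_norm nT0) ler_pM2r ?invr_gt0.
Qed.

End Counting.

(** * Solving the system for one group *)

Section System.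
Variables (A : finType) (Dom : A -> finType) (Y : finType) (X : Type).
Variables (T : dataset Dom Y X) (s : group Dom) (i : Y).
Hypothesis label_occurs : forall y : Y, (0 < num_y T y)%N.
Implicit Types (y : Y) (c m : int) (d : Y -> int).

Let freq_gt0 y : 0 < freq_y T y.
Proof. exact: freq_y_gt0. Qed.

Let freq_neq0 y : freq_y T y != 0.
Proof. by rewrite gt_eqF. Qed.

Lemma targetE c y :
  target T s i c y = freq_y T y * (((num_sy T s i)%:Z + c)%:~R / freq_y T i).
Proof. by rewrite /target mulrAC mulrA. Qed.

Lemma target_free c : target T s i c i = ((num_sy T s i)%:Z + c)%:~R.
Proof. by rewrite /target divff ?mul1r. Qed.

Lemma general_solution_free c : general_solution T s i c i = c.
Proof. by rewrite /general_solution target_free intrKfloor addKr. Qed.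

Lemma solves_systemE d :
  solves_system T s i d <->
  forall y, ((num_sy T s y)%:Z + d y)%:~R = target T s i (d i) y.
Proof.
split=> sol y; first by rewrite targetE -(sol y) mulrC divfK.
by rewrite sol targetE mulrAC divff ?mul1r.
Qed.

(** An exact solution makes each target an integer count, on which the floor is the identity;
    conversely, integral targets let the floor be dropped. *)
Lemma solves_system_floor d :
  solves_system T s i d <->
  (forall y, d y = general_solution T s i (d i) y) /\
  (forall y, target T s i (d i) y \is a Num.int).
Proof.
split=> [/solves_systemE sol|[dE dint]].
  split=> y; last by rewrite -sol intr_int.
  by rewrite /general_solution -sol intrKfloor addKr.
by apply/solves_systemE => y; rewrite dE addNKr floorK.
Qed.

(** This is the adjunction between floor and the embedding of the integers: the formula gives the
    largest integer keeping the ratio of [y] at most that of [i]. *)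
Lemma le_general_solution c y m :
  m <= general_solution T s i c y <->
  ((num_sy T s y)%:Z + m)%:~R / freq_y T y
    <= ((num_sy T s i)%:Z + c)%:~R / freq_y T i.
Proof.
rewrite /general_solution -lerBlDl opprK addrC floor_ge_int targetE.
by rewrite ler_pdivrMr // mulrC.
Qed.

(** Take [m = 0] in [le_general_solution]: the argmax inequality, scaled by [size T], settles
    [c = 0], and a larger [c] only raises the right side. *)
Lemma general_solution_ge0 c y :
  is_argmax T s i -> 0 <= c -> 0 <= general_solution T s i c y.
Proof.
move=> /(_ y) max_i c0; apply/le_general_solution; rewrite addr0.
have T0 : 0 < (size T)%:R :> rat.
  by rewrite ltr0n (leq_trans (label_occurs y)) ?count_size.
apply: (@le_trans _ _ ((num_sy T s i)%:R / freq_y T i)).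
  by rewrite /freq_y !invf_div !mulrA ![_ * (size T)%:R]mulrC -!mulrA ler_pM2l.
by rewrite ler_pM2r ?invr_gt0 // intrD lerDl ler0z.
Qed.

(* Choosing [c] so that [s y_i + c] is a multiple of [y_i] makes every target
   an integer. *)
Lemma exists_exact_value c0 :
  exists2 c, c0 <= c & solves_system T s i (general_solution T s i c).
Proof.
(* Since [num_y T i >= 1], the multiple is at least [k], and removing [num_sy T s i] leaves at least
   [c0]. *)
pose k := (`|c0| + num_sy T s i)%N.
pose c : int := (num_y T i * k)%N%:Z - (num_sy T s i)%:Z.
exists c; first by have := label_occurs i; rewrite /c /k; nia.
apply/solves_system_floor; rewrite general_solution_free; split=> // y.
have i0 : (num_y T i)%:R != 0 :> rat by rewrite pnatr_eq0 -lt0n.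
have T0 : (size T)%:R != 0 :> rat.
  by rewrite pnatr_eq0 -lt0n (leq_trans (label_occurs y)) ?count_size.
suff -> : target T s i c y = (num_y T y * k)%N%:~R by apply: intr_int.
rewrite targetE /c addrC subrK /freq_y -!pmulrn !natrM; field.
by rewrite T0 i0.
Qed.

End System.

Theorem theorem7p1 (A : finType) (Dom : A -> finType) (Y : finType) (X : Type)
    (T : dataset Dom Y X) (i : group Dom -> Y)
    (label_occurs : forall y : Y, (0 < num_y T y)%N)
    (i_argmax : forall s : group Dom, is_argmax T s (i s)) :
  (* the integer solutions of the system are given by the floor formula *)
  (forall (s : group Dom) (d : Y -> int),
     solves_system T s (i s) d <->
     (forall y : Y, d y = general_solution T s (i s) (d (i s)) y) /\
     (forall y : Y, target T s (i s) (d (i s)) y \is a Num.int)) /\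
  (* the free variable ranges over the non-negative integers: the formula
     returns it at [i s], is non-negative, and satisfies each equation up to
     the rounding of a single tuple *)
  (forall (s : group Dom) (c : int), 0 <= c ->
     general_solution T s (i s) c (i s) = c /\
     forall y : Y,
       0 <= general_solution T s (i s) c y /\
       forall m : int,
         m <= general_solution T s (i s) c y <->
         ((num_sy T s y)%:Z + m)%:~R / freq_y T y
           <= ((num_sy T s (i s))%:Z + c)%:~R / freq_y T (i s)) /\
  (* there are arbitrarily large values at which no rounding takes place *)
  (forall (s : group Dom) (c0 : int), exists2 c : int,
     c0 <= c & solves_system T s (i s) (general_solution T s (i s) c)) /\
  (* the mitigated dataset T_m = T ++ N *)
  (forall c : group Dom -> int, (forall s : group Dom, 0 <= c s) ->
     (exists N : dataset Dom Y X,
        contains_exactly N (fun s => general_solution T s (i s) (c s))) /\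
     (forall N : dataset Dom Y X,
        contains_exactly N (fun s => general_solution T s (i s) (c s)) ->
        (forall s : group Dom, (0 < num_s (T ++ N) s)%N) ->
        ((forall s : group Dom,
            solves_system T s (i s) (general_solution T s (i s) (c s))) ->
         unbiased (T ++ N)) /\
        (forall (s : group Dom) (y : Y),
           `|freq_sy (T ++ N) s y - freq_y (T ++ N) y|
             < #|Y|%:R * ((num_s (T ++ N) s)%:R^-1
                          + #|group Dom|%:R / (size (T ++ N))%:R)))).
Proof.
have ge0 s c y : 0 <= c -> 0 <= general_solution T s (i s) c y.
  by move=> c0; apply: general_solution_ge0.
split; first by move=> s d; apply: solves_system_floor.
split.
  move=> s c c0; split; first exact: general_solution_free.
  by move=> y; split=> [|m]; [apply: ge0 | apply: le_general_solution].
split; first by move=> s c0; apply: exists_exact_value.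
move=> c c0; split.
  (* A row of [T] supplies the filler value in [X]. If [T] is empty, no group exists, since its
     label [i s] would have to occur. *)
  case ET: T => [|t r]; last first.
    by rewrite -ET; apply: (exists_dataset (other t)) => s y; apply: ge0.
  by exists [::] => s; have := label_occurs (i s); rewrite ET.
move=> N NE s0.
(* The existing count cancels against the negative term of the formula, leaving the bare floor. *)
have sumN s y : (num_sy (T ++ N) s y)%:R
    = (Num.floor (target T s (i s) (c s) y))%:~R :> rat.
  by rewrite num_syD natrD !pmulrn NE -intrD addrC addrAC addNr add0r.
pose K s := ((num_sy T s (i s))%:Z + c s)%:~R / freq_y T (i s).
have f0 y : 0 < freq_y T y by apply: freq_y_gt0.
(* The group [s] yields an occurring label [i s], hence a nonempty [T]. *)
have f1 (s : group Dom) : \sum_y freq_y T y = 1.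
  exact: sum_freq_y (leq_trans (label_occurs (i s)) (count_size _ _)).
split=> [sol s|s y].
  apply: (unbiased_of_proportional (f1 s) (K := K)) => // s' y.
  have /solves_system_floor := sol s'.
  rewrite general_solution_free // => /(_ label_occurs)[_ /(_ y) tint].
  by rewrite sumN floorK // targetE.
apply: (@bias_of_nearly_proportional _ _ _ _ _ (freq_y T) K) => //.
- by move=> z; apply: ltW.
- exact: f1.
move=> s' z; rewrite sumN -targetE.
have := floor_itv (target T s' (i s') (c s') z).
by rewrite intrD.
Qed.
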